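(* The map $$\Phi:\mathrm{Rat}_d^1\longrightarrow (V_{d+1}\oplus V_{d-1})\setminus\mathcal N,\qquad \Phi(\phi)=(\mathcal I_\phi,\mathcal J_\phi),$$ is bijective. Moreover, for any $(f,g)\in (V_{d+1}\oplus V_{d-1})\setminus\mathcal N$, $$\Phi^{-1}(f,g)=\frac{xg+\frac{\partial f}{\partial y}}{yg-\frac{\partial f}{\partial x}}.$$
   Context: $k$ is an algebraically closed field of characteristic zero and $d>1$ is an integer. $V_m$ denotes the $(m+1)$-dimensional space of homogeneous polynomials of degree $m$ in $k[x,y]$; its elements, taken up to multiplication by a scalar, are called binary forms of degree $m$. $\mathrm{Rat}_d^1$ is the space of rational functions of degree $d$ on $\mathbb{P}^1_k$, i.e. the complement in $\mathbb{P}^{2d+1}$ of the vanishing locus of the resultant: its points are $\phi=[f_0:f_1]$, also written $\phi=f_0/f_1$, with $f_0,f_1\in k[x,y]$ homogeneous of degree $d$ and $\mathrm{Res}(f_0,f_1)\neq 0$. For $\phi=f_0/f_1$, $\mathcal I_\phi=yf_0-xf_1\in V_{d+1}$ and $\mathcal J_\phi=\frac{\partial f_0}{\partial x}+\frac{\partial f_1}{\partial y}\in V_{d-1}$. For $(f,g)\in V_{d+1}\oplus V_{d-1}$, the modular resultant is $\Delta_{(f,g)}=\mathrm{Res}\left(xg+\frac{\partial f}{\partial y},\; yg-\frac{\partial f}{\partial x}\right)$, the resultant of two binary forms of degree $d$, and $\mathcal N=\{(f,g)\in V_{d+1}\oplus V_{d-1} : \Delta_{(f,g)}=0\}$. *)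

(* Defs.v *)
From HB Require Import structures.
From mathcomp Require Import all_boot all_order all_algebra.
From mathcomp Require Import classical_sets functions.
From mathcomp Require Import mpoly.

Set Implicit Arguments.
Unset Strict Implicit.
Unset Printing Implicit Defensive.

Import GRing.Theory.

Local Open Scope ring_scope.
Local Open Scope classical_set_scope.

Definition ix : 'I_2 := ord0.
Definition iy : 'I_2 := ord_max.

Section BinaryForms.
Variable k : closedFieldType.

Definition V (m : nat) : vectType k := dhomog 2 k m.

Lemma dhomog_mulX (i : 'I_2) (m : nat) (p : {mpoly k[2]}) :
  p \is m.-homog -> 'X_i * p \is m.+1.-homog.
Proof.
move=> hp; rewrite -[m.+1]add1n; apply: dhomogM => //.
by rewrite dhomogX; apply/eqP; exact: mdeg1.
Qed.

Lemma dhomog_deriv (i : 'I_2) (m : nat) (p : {mpoly k[2]}) :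
  p \is m.-homog -> p^`M(i) \is m.-1.-homog.
Proof.
move=> hp; apply/dhomogP => u; rewrite mcoeff_msupp mcoeff_deriv => nz.
have : (u + U_(i))%MM \in msupp p.
  by rewrite mcoeff_msupp; apply: contraNneq nz => ->; rewrite mul0rn.
by move/(dhomog_mf hp) => /= <-; rewrite mdegD mdeg1 addn1.
Qed.

(* The coefficient of x^(m-j) y^j in F. *)
Definition bcoef (m : nat) (F : {mpoly k[2]}) (j : nat) : k :=
  F@_(U_(ix) *+ (m - j)%N + U_(iy) *+ j)%MM.

(* Resultant of a form F of degree m and a form G of degree n, as the           *)
(* determinant of the Sylvester matrix of order n + m: its rows are the         *)
(* coefficients of x^(n-1-i) y^i F (i < n) and x^(m-1-i) y^i G (i < m) in the   *)
(* basis x^(m+n-1-j) y^j. The formal degrees m and n are arguments because the  *)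
(* library's [resultant] of dehomogenized polynomials uses their actual         *)
(* degrees, and so misses a common zero at infinity.                            *)
Definition Res (m n : nat) (F G : {mpoly k[2]}) : k :=
  \det (col_mx
    (\matrix_(i < n, j < n + m)
       if (i <= j <= i + m)%N then bcoef m F (j - i) else 0)
    (\matrix_(i < m, j < n + m)
       if (i <= j <= i + n)%N then bcoef n G (j - i) else 0)).

Section Degree.
Variable d : nat.

Lemma I_homog (f : V d * V d) :
  'X_iy * (f.1 : {mpoly k[2]}) - 'X_ix * (f.2 : {mpoly k[2]}) \is d.+1.-homog.
Proof. by apply: rpredB; apply: dhomog_mulX; exact: dhomog_is_dhomog. Qed.

Lemma J_homog (f : V d * V d) :
  (f.1 : {mpoly k[2]})^`M(ix) + (f.2 : {mpoly k[2]})^`M(iy) \is d.-1.-homog.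
Proof. by apply: rpredD; apply: dhomog_deriv; exact: dhomog_is_dhomog. Qed.

Definition I_form (f : V d * V d) : V d.+1 := DHomog (I_homog f).
Definition J_form (f : V d * V d) : V d.-1 := DHomog (J_homog f).

Definition IJ (f : V d * V d) : V d.+1 * V d.-1 := (I_form f, J_form f).

Lemma IJ_is_linear : linear IJ.
Proof.
move=> a [p q] [r s]; congr pair; apply: val_inj => /=.
  by rewrite !mulrDr -!scalerAr scalerBr opprD addrACA.
by rewrite !mderivD !mderivZ scalerDr addrACA.
Qed.

HB.instance Definition _ :=
  GRing.isLinear.Build k (V d * V d)%type (V d.+1 * V d.-1)%type _ IJ
    IJ_is_linear.

(* The point [v] of P(E) is the line <[v]> in E, for v != 0. Here v != 0 is     *)
(* implied by the nonvanishing of the resultant as soon as d > 0.               *)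
Definition Rat1 : set {vspace V d * V d} :=
  [set <[f]>%VS | f in [set f : V d * V d | Res d d f.1 f.2 != 0]].

(* Induced by IJ on lines, see [Phi_line]. *)
Definition Phi (U : {vspace V d * V d}) : {vspace V d.+1 * V d.-1} :=
  (linfun IJ @: U)%VS.

Lemma Phi_line (f : V d * V d) : Phi <[f]> = <[(I_form f, J_form f)]>%VS.
Proof. by rewrite /Phi limg_line lfunE. Qed.

Definition inv_num (f : V d.+1) (g : V d.-1) : {mpoly k[2]} :=
  'X_ix * (g : {mpoly k[2]}) + (f : {mpoly k[2]})^`M(iy).
Definition inv_den (f : V d.+1) (g : V d.-1) : {mpoly k[2]} :=
  'X_iy * (g : {mpoly k[2]}) - (f : {mpoly k[2]})^`M(ix).

Definition Delta (f : V d.+1) (g : V d.-1) : k :=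
  Res d d (inv_num f g) (inv_den f g).

Definition N : set (V d.+1 * V d.-1) := [set v | Delta v.1 v.2 = 0].

(* The complement of N, taken projectively: f and g are scaled simultaneously. *)
Definition complN : set {vspace V d.+1 * V d.-1} :=
  [set <[v]>%VS | v in ~` N].

Hypothesis d_gt1 : (1 < d)%N.

Lemma inv_num_homog (f : V d.+1) (g : V d.-1) : inv_num f g \is d.-homog.
Proof.
apply: rpredD; last exact: (@dhomog_deriv iy d.+1 _ (dhomog_is_dhomog f)).
have := @dhomog_mulX ix d.-1 _ (dhomog_is_dhomog g).
by rewrite prednK ?(ltnW d_gt1).
Qed.

Lemma inv_den_homog (f : V d.+1) (g : V d.-1) : inv_den f g \is d.-homog.
Proof.
apply: rpredB; last exact: (@dhomog_deriv ix d.+1 _ (dhomog_is_dhomog f)).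
have := @dhomog_mulX iy d.-1 _ (dhomog_is_dhomog g).
by rewrite prednK ?(ltnW d_gt1).
Qed.

Definition inv_num_form (f : V d.+1) (g : V d.-1) : V d :=
  DHomog (inv_num_homog f g).
Definition inv_den_form (f : V d.+1) (g : V d.-1) : V d :=
  DHomog (inv_den_homog f g).

End Degree.
End BinaryForms.

Arguments Rat1 : clear implicits.
Arguments complN : clear implicits.

(* Main.v *)
(* By Euler's identity, the linear maps (f0, f1) |-> (I, J) and                 *)
(* (f, g) |-> (x g + f_y, y g - f_x) are inverse to each other up to the scalar *)
(* d + 1, which is nonzero in characteristic zero; rescaling both forms does    *)
(* not affect the vanishing of their resultant.                                 *)

Require Import Defs.
From mathcomp Require Import all_boot all_order all_algebra.
From mathcomp Require Import ring.
From mathcomp Require Import classical_sets functions.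
From mathcomp Require Import mpoly.

Set Implicit Arguments.
Unset Strict Implicit.
Unset Printing Implicit Defensive.

Import GRing.Theory.

Local Open Scope ring_scope.
Local Open Scope classical_set_scope.

(** Euler's identity [euler_mderiv2] makes [IJ] and [IJ_inv] compose, both ways, to multiplication
    by d + 1 ([IJ_invK], [IJK]). A nonzero scalar does not move a line, so these maps are mutually
    inverse on lines. By [ResZ], [Delta] at [IJ f] is a power of d + 1 times the resultant of [f],
    so the two nonvanishing conditions correspond. *)

Lemma mderivX_var (n : nat) (R : comNzRingType) (i j : 'I_n) :
  ('X_j)^`M(i) = (j == i)%:R :> {mpoly R[n]}.
Proof.
rewrite mderivX mnm1E; case: eqVneq => [->|_]; last by rewrite scale0r.
by rewrite -{1}[U_(i)%MM]addm0 addmC addmK mpolyX0 scale1r.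
Qed.

Lemma mulX_mderivX (n : nat) (R : comNzRingType) (i : 'I_n) (m : 'X_{1..n}) :
  'X_i * ('X_[m])^`M(i) = 'X_[m] *+ m i :> {mpoly R[n]}.
Proof.
rewrite mderivX -scalerAr -mpolyXD scaler_nat.
(* Exponent subtraction truncates at 0, so [m i = 0] is treated apart; both sides are then 0. *)
have [->|mi_neq0] := eqVneq (m i) 0%N; first by rewrite !mulr0n.
by rewrite addmC submK // lep1mP.
Qed.

(** Each summand multiplies a monomial by one of its exponents, and the exponents add up to d. *)
Lemma euler_mderiv (n : nat) (R : comNzRingType) (d : nat) (p : {mpoly R[n]}) :
  p \is d.-homog -> \sum_(i < n) 'X_i * p^`M(i) = p *+ d.
Proof.
move=> hp; rewrite {2}[p]mpolyE -sumrMnl.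
under eq_bigr => i _.
  rewrite {1}[p]mpolyE raddf_sum mulr_sumr /=.
  under eq_bigr => m _ do rewrite mderivZ -scalerAr mulX_mderivX.
  over.
rewrite exchange_big; apply: eq_big_seq => m /(dhomog_mf hp) /= <-.
by rewrite -scaler_sumr sumrMnr mdegE scalerMnr.
Qed.

Lemma euler_mderiv2 (R : comNzRingType) (d : nat) (p : {mpoly R[2]}) :
  p \is d.-homog -> 'X_ix * p^`M(ix) + 'X_iy * p^`M(iy) = p *+ d.
Proof.
move=> /euler_mderiv <-; rewrite big_ord_recl big_ord1.
by congr (_ + 'X_ _ * p^`M(_)); exact: val_inj.
Qed.

(** All n + m rows of the Sylvester matrix are scaled by c. *)
Lemma ResZ (k : closedFieldType) (m n : nat) (c : k) (F G : {mpoly k[2]}) :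
  Res m n (c *: F) (c *: G) = c ^+ (n + m) * Res m n F G.
Proof.
rewrite /Res -detZ scale_col_mx; congr (\det (col_mx _ _));
  apply/matrixP => i j; rewrite !mxE; case: ifP; rewrite ?mulr0 // => _;
  by rewrite /bcoef mcoeffZ.
Qed.

Section Inverse.
Variables (k : closedFieldType) (d : nat) (d_gt1 : (1 < d)%N).

Definition IJ_inv (v : V k d.+1 * V k d.-1) : V k d * V k d :=
  (inv_num_form d_gt1 v.1 v.2, inv_den_form d_gt1 v.1 v.2).

(** The terms xyg cancel in the first component, leaving x f_x + y f_y = (d + 1) f; the mixed
    partials of f cancel in the second, leaving 2g + x g_x + y g_y = (2 + (d - 1)) g. *)
Lemma IJ_invK v : IJ (IJ_inv v) = d.+1%:R *: v.
Proof.
case: v => f g; congr pair; apply: val_inj; rewrite /= scaler_nat.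
  have <- := euler_mderiv2 (dhomog_is_dhomog f).
  rewrite /inv_num /inv_den; ring.
have := euler_mderiv2 (dhomog_is_dhomog g).
rewrite /inv_num /inv_den mderivD mderivB !mderivM !mderivX_var /= => eg.
rewrite (mderiv_comm ix iy).
transitivity ((g : {mpoly k[2]}) *+ 2 + (g : {mpoly k[2]}) *+ d.-1).
  by rewrite -eg; ring.
by rewrite -mulrnDr add2n prednK // ltnW.
Qed.

(** Here x (p_x + q_y) + (yp - xq)_y = p + x p_x + y p_y = (d + 1) p, and similarly for q. *)
Lemma IJK f : IJ_inv (IJ f) = d.+1%:R *: f.
Proof.
case: f => p q; congr pair; apply: val_inj;
  rewrite /= scaler_nat mulrSr -?(euler_mderiv2 (dhomog_is_dhomog p))
    -?(euler_mderiv2 (dhomog_is_dhomog q)) /inv_num /inv_den /= !mderivB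
    !mderivM !mderivX_var /=; ring.
Qed.

End Inverse.

Theorem lemma2 (k : closedFieldType) (char_k : [pchar k] =i pred0)
    (d : nat) (d_gt1 : (1 < d)%N) :
  set_bij (Rat1 k d) (complN k d) (@Phi k d) /\
  (forall (f : V k d.+1) (g : V k d.-1), ~ N (f, g) ->
     Rat1 k d `&` @Phi k d @^-1` [set <[(f, g)]>%VS] =
     [set <[(inv_num_form d_gt1 f g, inv_den_form d_gt1 f g)]>%VS]).
Proof.
have d1_neq0 : d.+1%:R != 0 :> k by rewrite ((pcharf0P k).1 char_k).
have line_scale (E : vectType k) (v : E) : (<[d.+1%:R *: v]> = <[v]>)%VS.
  apply/eqP; rewrite eqEsubv -!memvE memvZ ?memv_line //=.
  by rewrite -[X in X \in _](scalerK d1_neq0) memvZ ?memv_line.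
(* [IJ] has trivial kernel by [IJK], so every subspace, not only a line, is recovered from its
   image. *)
have Phi_inj : injective (@Phi k d).
  apply: (can_inj (g := fun U => ((linfun (@IJ k d))^-1 @: U)%VS)) => U.
  rewrite -limg_comp lker0_compVf ?lim1g //; apply/lker0P => u v.
  rewrite !lfunE => /(congr1 (IJ_inv d_gt1)); rewrite !IJK.
  exact: scalerI.
have Phi_inv (v : V k d.+1 * V k d.-1) : Phi <[IJ_inv d_gt1 v]>%VS = <[v]>%VS.
  by rewrite Phi_line -/(IJ _) IJ_invK line_scale.
have Rat1_inv (v : V k d.+1 * V k d.-1) : ~ N v -> Rat1 k d <[IJ_inv d_gt1 v]>%VS.
  by move=> /eqP Nv; exists (IJ_inv d_gt1 v).
split; last first.
  move=> f g Nfg; apply/seteqP; split=> U /=.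
    by case=> _ PhiU; apply: Phi_inj; rewrite PhiU -(Phi_inv (f, g)).
  by move=> ->; split; [exact: (Rat1_inv (f, g))|exact: (Phi_inv (f, g))].
split.
- move=> _ [f Rf <-]; rewrite Phi_line; exists (IJ f) => //= Nf.
  (* [Delta] is by definition the resultant of the components of [IJ_inv], to which [IJK]
     applies. *)
  have : Delta (IJ f).1 (IJ f).2 =
         Res d d (d.+1%:R *: val f.1) (d.+1%:R *: val f.2).
    rewrite -[_ *: val f.1]/(val (d.+1%:R *: f).1).
    by rewrite -[_ *: val f.2]/(val (d.+1%:R *: f).2) -(IJK d_gt1).
  rewrite Nf ResZ => /esym/eqP; rewrite mulf_eq0 expf_eq0 (negPf d1_neq0) andbF.
  by apply/negP.
- by move=> U U' _ _; exact: Phi_inj.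
- by move=> _ [v Nv <-]; exists <[IJ_inv d_gt1 v]>%VS => //; exact: Rat1_inv.
Qed.
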